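(* Let $F(x,t)=\sum_{i\ge0}F_i(x)t^i$ be a family of polynomials of degree $n'$ with coefficients in $A$, with $F_0=\prod_\nu f_\nu^{n_\nu}$, where the $f_\nu\in A[x]$ are coprime and monic and $f_\nu=\prod_{\ell}(x-a_{\nu\ell})$ with all $a_{\nu\ell}\in\overline K$ distinct. Suppose that for each $\nu$ with $n_\nu>1$ the family $F$ satisfies $(\alpha_\nu,\delta_{\nu,n(\nu)})$-Zd for $f_\nu$. Then there is $c\in k\setminus\{0\}$ such that $$\operatorname{Ver}(F)=\frac{c\ \prod_\nu\operatorname{Res}\big(f_\nu,\delta_{\nu,n(\nu)}^{\,n_\nu-1}\big)\ \prod_\nu\Big(\prod_{\nu'\ne\nu}\operatorname{Res}(f_\nu,f_{\nu'})^{n_{\nu'}}\Big)}{\prod_\nu\operatorname{Res}\big(f_\nu,\alpha_\nu^{\,n_\nu-1}\big)},$$ where the factors $\operatorname{Res}(f_\nu,\delta_{\nu,n(\nu)}^{n_\nu-1})$ and $\operatorname{Res}(f_\nu,\alpha_\nu^{n_\nu-1})$ are understood to be $1$ when $n_\nu=1$.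
   Context: $k$ is an algebraically closed field of characteristic zero, $A$ is a $k$-algebra and integral domain, $K=\operatorname{Frac}(A)$ and $\overline K$ is an algebraic closure of $K$. Coprimality and gcd of polynomials are taken in $K[x]$. For $h=a_n\prod_{i=1}^n(x-\alpha_i)$ and a polynomial $g$ of degree $m$, $\operatorname{Res}(h,g)=a_n^m\prod_ig(\alpha_i)$. Family of polynomials of degree $n'$ with coefficients in $A$: $F(x,t)=\sum_{i\ge0}F_i(x)t^i$ with $F_i\in A[x]$, $\deg F_0=n'$, $\deg F_i\le n'$ for $i>0$. View $F$ as a polynomial in $x$ of degree $n'$ over $A[[t]]$, with leading coefficient $u(t)$; here $u(0)=1$ because $F_0$ is monic. The $t$-roots of $F$ are its $n'$ roots (with multiplicity) in $\bigcup_N\overline K((t^{1/N}))$; they lie in $\bigcup_N\overline K[[t^{1/N}]]$, and their constant terms are the roots of $F_0$. For a nonzero Puiseux series $g$ in $t$, $g_0$ is the coefficient of its lowest power of $t$. Zeuthen decomposition: for $n\in\mathbb Z_{\ge1}$ and $\alpha,\delta_n\in A[x]$, $F$ satisfies $(\alpha,\delta_n)$-Zd for $f_\nu$ if $n_\nu>1$, $\gcd(\alpha\delta_n,f_\nu)=1$ and $$\alpha F(t)=(f_\nu\beta_0+\beta_1t+\cdots+\beta_{n-1}t^{n-1})^{n_\nu}+\delta_nt^n+O(t^{n+1})$$ with $\beta_i\in A[x]$ for $i=0,\dots,n-1$; here $O(t^{n+1})$ denotes an element of $t^{n+1}A[x][[t]]$. In the claim, $n=n(\nu)$ may depend on $\nu$.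 Generalized formal discriminant: for each $(\nu,\ell)$ exactly $n_\nu$ $t$-roots have constant term $a_{\nu\ell}$; denote them $s_{\nu\ell1},\dots,s_{\nu\ell n_\nu}$ (any labelling). Put $s_i':=f_\nu-\prod_\ell(x-s_{\nu\ell i})$ for $1\le i\le n_\nu$, and let $Q_\nu$ be $u(t)$ times the product of $(x-s)$ over the $t$-roots $s$ with $f_\nu(s(0))\ne0$, so $F=Q_\nu\prod_i(f_\nu-s'_i)$. Then $\Delta(F,f_\nu)(x,t)$ is the discriminant in $w$ of $Q_\nu\prod_{i=1}^{n_\nu}(w-s_i')$, i.e. $\Delta(F,f_\nu)(x,t)=Q_\nu^{2n_\nu-2}\prod_{i<j}(s'_i-s'_j)^2$ (equal to $1$ if $n_\nu=1$). Vertex: $$\operatorname{Ver}(F):=\prod_{\nu,\ell}\Delta(F,f_\nu)(a_{\nu\ell},t)_0\prod_{\nu<\nu'}\operatorname{Res}(f_\nu,f_{\nu'})^{2(n_\nu+n_{\nu'}-n_\nu n_{\nu'})}.$$ *)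

(* Defs.v *)
From HB Require Import structures.
From mathcomp Require Import all_boot all_order all_algebra.
From mathcomp Require Import boolp.

Set Implicit Arguments.
Unset Strict Implicit.
Unset Printing Implicit Defensive.

Import GRing.Theory.
Local Open Scope ring_scope.

(* {fps R} is the ring R[[t]] of formal power series. *)
Record fps (R : Type) := Fps { fps_coef : nat -> R }.
Notation "{ 'fps' R }" := (fps R) (format "{ 'fps'  R }").

Section FpsRing.
Variable R : comNzRingType.
Implicit Types f g h : {fps R}.

HB.instance Definition _ := gen_eqMixin {fps R}.
HB.instance Definition _ := gen_choiceMixin {fps R}.

Definition fpsC (c : R) : {fps R} := Fps (fun i => if i is 0%N then c else 0).
Definition fpsT : {fps R} := Fps (fun i => (i == 1%N)%:R).
Definition fps_opp f : {fps R} := Fps (fun i => - fps_coef f i).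
Definition fps_add f g : {fps R} := Fps (fun i => fps_coef f i + fps_coef g i).
Definition fps_mul f g : {fps R} :=
  Fps (fun n => \sum_(i < n.+1) fps_coef f i * fps_coef g (n - i)).

Lemma fpsP f g : (forall i, fps_coef f i = fps_coef g i) -> f = g.
Proof. by case: f g => [f] [g] /= fg; congr Fps; apply/funext. Qed.

Lemma fps_addA : associative fps_add.
Proof. by move=> f g h; apply: fpsP => i; apply: addrA. Qed.
Lemma fps_addC : commutative fps_add.
Proof. by move=> f g; apply: fpsP => i; apply: addrC. Qed.
Lemma fps_add0 : left_id (fpsC 0) fps_add.
Proof. by move=> f; apply: fpsP => -[|i]; apply: add0r. Qed.
Lemma fps_addN : left_inverse (fpsC 0) fps_opp fps_add.
Proof. by move=> f; apply: fpsP => -[|i]; apply: addNr. Qed.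

HB.instance Definition _ :=
  GRing.isZmodule.Build {fps R} fps_addA fps_addC fps_add0 fps_addN.

Definition fps_trunc n f : {poly R} := \poly_(i < n.+1) fps_coef f i.

Lemma coef_fps_trunc n f i : (i <= n)%N -> (fps_trunc n f)`_i = fps_coef f i.
Proof. by move=> le_in; rewrite coef_poly ltnS le_in. Qed.

Lemma coef_fps_mul n f g i : (i <= n)%N ->
  fps_coef (fps_mul f g) i = (fps_trunc n f * fps_trunc n g)`_i.
Proof.
move=> le_in; rewrite coefM; apply: eq_bigr => j _.
have le_jn : (j <= n)%N by apply: leq_trans le_in; rewrite -ltnS.
by rewrite !coef_fps_trunc // (leq_trans (leq_subr _ _)).
Qed.

Lemma fps_mulC : commutative fps_mul.
Proof.
by move=> f g; apply: fpsP => n; rewrite !(@coef_fps_mul n) // mulrC.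
Qed.

Lemma fps_mulA : associative fps_mul.
Proof.
move=> f g h; apply: fpsP => n.
transitivity (fps_trunc n f * (fps_trunc n g * fps_trunc n h))`_n.
  rewrite coefM; apply: eq_bigr => i _.
  rewrite coef_fps_trunc; last by rewrite -ltnS.
  by rewrite (@coef_fps_mul n) // leq_subr.
rewrite mulrA coefM; apply: eq_bigr => i _.
rewrite coef_fps_trunc ?leq_subr // (@coef_fps_mul n) //.
by rewrite -ltnS.
Qed.

Lemma fps_mul1 : left_id (fpsC 1) fps_mul.
Proof.
move=> f; apply: fpsP => n /=; rewrite big_ord_recl /= mul1r subn0 big1 ?addr0 //.
by move=> i _; rewrite mul0r.
Qed.

Lemma fps_mulDl : left_distributive fps_mul fps_add.
Proof.
move=> f g h; apply: fpsP => n /=; rewrite -big_split /=.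
by apply: eq_bigr => i _; rewrite mulrDl.
Qed.

Lemma fps_nonzero1 : fpsC 1 != 0.
Proof.
by apply/eqP => /(congr1 (fun f => fps_coef f 0)) /eqP; rewrite oner_eq0.
Qed.

HB.instance Definition _ := GRing.Zmodule_isComNzRing.Build {fps R}
  fps_mulA fps_mulC fps_mul1 fps_mulDl fps_nonzero1.

(* g_0 : the lowest nonzero coefficient; 0 is a dummy value for g = 0. *)
Definition lowcoef (g : {fps R}) : R :=
  if pselect (exists i, fps_coef g i != 0) is left ex
  then fps_coef g (ex_minn ex) else 0.

End FpsRing.

Arguments fpsT {R}.

(* The map A[[t]] -> L[[tau]] induced by j : A -> L and t |-> tau ^ N. Every
   finite family in the union over N of the L[[t^{1/N}]] lies in one of them,
   and L[[t^{1/N}]] is the ring {fps L} in the variable tau = t^{1/N}. *)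
Definition fps_ramify (A L : comNzRingType) (j : A -> L) (N : nat)
    (g : {fps A}) : {fps L} :=
  Fps (fun i => if (N %| i)%N then j (fps_coef g (i %/ N)) else 0).

(* Res(h, g) = a_n^m prod_i g(alpha_i) for h = a_n prod_i (x - alpha_i) and
   m = deg g. *)
Definition Res (L : closedFieldType) (h g : {poly L}) : L :=
  lead_coef h ^+ (size g).-1 *
  \prod_(z <- sval (closed_field_poly_normal h)) g.[z].

Section Families.
Variable A : idomainType.

Definition is_family (n' : nat) (F : {fps {poly A}}) : Prop :=
  size (fps_coef F 0) = n'.+1 /\
  forall i, (0 < i)%N -> (size (fps_coef F i) <= n'.+1)%N.

(* F viewed as a polynomial in x over A[[t]] *)
Definition family_xpoly (n' : nat) (F : {fps {poly A}}) : {poly {fps A}} :=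
  \poly_(j < n'.+1) Fps (fun i => (fps_coef F i)`_j).

Definition coprimeK (p q : {poly A}) : bool :=
  coprimep (map_poly (@tofrac A) p) (map_poly (@tofrac A) q).

(* F satisfies (alpha, delta)-Zd for f, where f has multiplicity m in F_0 and
   n is the order in t at which delta appears. *)
Definition Zd (F : {fps {poly A}}) (f : {poly A}) (m n : nat)
    (alpha delta : {poly A}) : Prop :=
  [/\ (1 < m)%N, (0 < n)%N, coprimeK (alpha * delta) f &
    exists (beta : nat -> {poly A}) (rest : {fps {poly A}}),
      fpsC alpha * F =
        (fpsC (f * beta 0%N) + \sum_(1 <= i < n) fpsC (beta i) * fpsT ^+ i) ^+ m
        + fpsC delta * fpsT ^+ n + rest * fpsT ^+ n.+1].

End Families.

Section Vertex.
Variables (A : idomainType) (L : closedFieldType) (j : A -> L).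
Variables (n' r N : nat) (F : {fps {poly A}}).
Variables (f : 'I_r -> {poly A}) (d mult : 'I_r -> nat).
Variable a : forall nu : 'I_r, 'I_(d nu) -> L.
Variable s : forall nu : 'I_r, 'I_(d nu) -> 'I_(mult nu) -> {fps L}.

Local Notation fL nu := (map_poly j (f nu)).

Definition family_xpolyL : {poly {fps L}} :=
  map_poly (fps_ramify j N) (family_xpoly n' F).

(* u(t), as an element of L[[tau]] *)
Definition family_lead : {fps L} :=
  fps_ramify j N (lead_coef (family_xpoly n' F)).

(* The s nu l i are the t-roots of F, with multiplicity, and for fixed nu, l
   the s nu l i are those with constant term a nu l. *)
Definition is_troots : Prop :=
  [/\ (0 < N)%N,
      family_xpolyL = family_lead *:
        \prod_(nu < r) \prod_(l < d nu) \prod_(i < mult nu) ('X - (s l i)%:P) &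
      forall (nu : 'I_r) (l : 'I_(d nu)) (i : 'I_(mult nu)),
        fps_coef (s l i) 0 = a l].

Definition tconj (nu : 'I_r) (i : 'I_(mult nu)) : {poly {fps L}} :=
  map_poly (@fpsC L) (fL nu) - \prod_(l < d nu) ('X - (s l i)%:P).

Definition tcofactor (nu : 'I_r) : {poly {fps L}} :=
  family_lead *:
    \prod_(nu1 < r) \prod_(l < d nu1)
      \prod_(i < mult nu1 | (fL nu).[fps_coef (s l i) 0] != 0)
        ('X - (s l i)%:P).

(* Delta(F, f_nu)(x, t) *)
Definition gen_disc (nu : 'I_r) : {poly {fps L}} :=
  tcofactor nu ^+ (2 * mult nu - 2) *
  \prod_(i < mult nu) \prod_(i1 < mult nu | (i < i1)%N)
    (tconj i - tconj i1) ^+ 2.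

Definition Ver : L :=
  (\prod_(nu < r) \prod_(l < d nu)
      lowcoef ((gen_disc nu).[fpsC (a l)])) *
  \prod_(nu < r) \prod_(nu1 < r | (nu < nu1)%N)
    Res (fL nu) (fL nu1) ^
      (2%:Z * ((mult nu)%:Z + (mult nu1)%:Z - (mult nu * mult nu1)%N%:Z)).

End Vertex.

(* Main.v *)
Require Import Defs.
From HB Require Import structures.
From mathcomp Require Import all_boot all_order all_algebra.
From mathcomp Require Import boolp ring.

Set Implicit Arguments.
Unset Strict Implicit.
Unset Printing Implicit Defensive.

Import GRing.Theory.
Local Open Scope ring_scope.

(* Fix nu with m = n_nu > 1 and a root a of f_nu, and put T = t^(1/N). Writing the
   Zeuthen decomposition as al F = G^m + de t^n + O(t^(n+1)), each t-root s_i at a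
   satisfies G(s_i)^m = - de(a) t^n + ..., so G(s_i) has order e = N n / m in T, and
   so do the differences s_i - s_j: s_i - s_j = (c_i - c_j) T^e + ... where
   G'(a) c_i runs through m-th roots of - de(a). Comparing orders in the
   x-derivative of al F at s_i shows that the c_i are distinct, hence are all the
   m-th roots of one constant. Since a - s_i has positive order, the differences of
   the s'_i at x = a have leading coefficients f_nu'(a) (c_i - c_j), and the
   discriminant of y^m - C gives the lowest coefficient of Delta(F, f_nu)(a, t). The
   factors f_nu'(a) cancel because beta_0^m = al * prod f_nu1^n_nu1 over nu1 <> nu.
   What remains is to count the exponents of Res(f_nu, f_nu1) = +- Res(f_nu1, f_nu). *)

(** * Power series: ring morphisms, monomials and leading terms *)

Section PowerSeries.
Variable R : comNzRingType.
Implicit Types (g h : {fps R}) (c d : R) (k l : nat).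

Definition fps_const g : R := fps_coef g 0.
Arguments fps_const : simpl never.

Fact fps_const_is_zmod_morphism : zmod_morphism fps_const.
Proof. by []. Qed.

Fact fps_const_is_monoid_morphism : monoid_morphism fps_const.
Proof. by split=> // g h; rewrite /fps_const /= big_ord1. Qed.

HB.instance Definition _ :=
  GRing.isZmodMorphism.Build {fps R} R fps_const fps_const_is_zmod_morphism.
HB.instance Definition _ :=
  GRing.isMonoidMorphism.Build {fps R} R fps_const fps_const_is_monoid_morphism.

Fact fpsC_is_zmod_morphism : zmod_morphism (@fpsC R).
Proof. by move=> c d; apply: fpsP => -[|i] //=; rewrite subr0. Qed.

Fact fpsC_is_monoid_morphism : monoid_morphism (@fpsC R).
Proof.
split=> // c d; apply: fpsP => -[|i] /=; first by rewrite big_ord1.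
by rewrite big_ord_recl /= mulr0 big1 ?addr0 // => j _; rewrite mul0r.
Qed.

HB.instance Definition _ :=
  GRing.isZmodMorphism.Build R {fps R} (@fpsC R) fpsC_is_zmod_morphism.
HB.instance Definition _ :=
  GRing.isMonoidMorphism.Build R {fps R} (@fpsC R) fpsC_is_monoid_morphism.

(** Identifies a polynomial expression in t inside [{fps R}], so that it can be compared
    coefficientwise with a polynomial. *)
Definition fps_of_poly (p : {poly R}) : {fps R} := Fps (fun i => p`_i).

Fact fps_of_poly_is_zmod_morphism : zmod_morphism fps_of_poly.
Proof. by move=> p q; apply: fpsP => i /=; rewrite coefB. Qed.

Fact fps_of_poly_is_monoid_morphism : monoid_morphism fps_of_poly.
Proof.
split=> [|p q]; apply: fpsP => i; last by rewrite /= coefM.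
by rewrite /= coef1; case: i.
Qed.

HB.instance Definition _ := GRing.isZmodMorphism.Build
  {poly R} {fps R} fps_of_poly fps_of_poly_is_zmod_morphism.
HB.instance Definition _ := GRing.isMonoidMorphism.Build
  {poly R} {fps R} fps_of_poly fps_of_poly_is_monoid_morphism.

Lemma fps_of_polyC c : fps_of_poly c%:P = fpsC c.
Proof. by apply: fpsP => i /=; rewrite coefC; case: i. Qed.

Lemma fps_of_poly_monomial c n : fps_of_poly (c%:P * 'X^n) = fpsC c * fpsT ^+ n.
Proof.
rewrite rmorphM rmorphXn /= fps_of_polyC; congr (_ * _ ^+ _).
by apply: fpsP => i /=; rewrite coefX.
Qed.

Lemma fps_coefTM g i :
  fps_coef (fpsT * g) i = if i is i'.+1 then fps_coef g i' else 0.
Proof.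
case: i => [|i] /=; first by rewrite big_ord1 mul0r.
rewrite 2!big_ord_recl mul0r add0r mul1r big1 ?addr0 => [|j _]; last first.
  by rewrite mul0r.
by congr fps_coef; rewrite subSS subn0.
Qed.

Lemma fps_coefTnM k g i :
  fps_coef (fpsT ^+ k * g) i = if (i < k)%N then 0 else fps_coef g (i - k).
Proof.
elim: k i => [|k IHk] i; first by rewrite mul1r subn0.
by rewrite exprS -mulrA fps_coefTM; case: i => [|i] //; rewrite IHk.
Qed.

Lemma fps_constT : fps_const fpsT = 0. Proof. by []. Qed.

Lemma fps_constC c : fps_const (fpsC c) = c. Proof. by []. Qed.

(** Quotient by T^k without the lower terms; k = 1 gives the tail in a Taylor step. *)
Definition fps_shift k g : {fps R} := Fps (fun i => fps_coef g (k + i)).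

(* [c = 0] is allowed: the statement then means that [g] is [O(T^(k+1))]. *)
Definition lead_term g k c := exists2 h, g = fpsT ^+ k * h & fps_const h = c.

Lemma lead_termP g k c :
  lead_term g k c <->
  (forall i, (i < k)%N -> fps_coef g i = 0) /\ fps_coef g k = c.
Proof.
split=> [[h -> <-]|[g0 gk]].
  by split=> [i ik|]; rewrite fps_coefTnM ?ik // ltnn subnn.
exists (fps_shift k g); last by rewrite /fps_const /= addn0.
apply: fpsP => i; rewrite fps_coefTnM; case: ltnP => [/g0 //|ki] /=.
by rewrite subnKC.
Qed.

Lemma lead_term_const g : lead_term g 0 (fps_const g).
Proof. by exists g; rewrite ?mul1r. Qed.

Lemma lead_termT k c g : fps_const g = c -> lead_term (fpsT ^+ k * g) k c.
Proof. by exists g. Qed.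

Lemma lead_termM g h k l c d :
  lead_term g k c -> lead_term h l d -> lead_term (g * h) (k + l) (c * d).
Proof.
move=> [g1 -> <-] [h1 -> <-]; exists (g1 * h1); last by rewrite rmorphM.
by rewrite exprD; ring.
Qed.

Lemma lead_termX g k c n :
  lead_term g k c -> lead_term (g ^+ n) (n * k) (c ^+ n).
Proof.
move=> gk; elim: n => [|n IHn]; first exact: (lead_term_const 1).
by rewrite !exprS mulSn; apply: lead_termM.
Qed.

Lemma lead_term_prod (I : Type) (r : seq I) (P : pred I) (g : I -> {fps R})
    (k : I -> nat) (c : I -> R) :
    (forall i, P i -> lead_term (g i) (k i) (c i)) ->
  lead_term (\prod_(i <- r | P i) g i)
    (\sum_(i <- r | P i) k i)%N (\prod_(i <- r | P i) c i).
Proof.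
move=> gk; elim: r => [|i r IHr]; first by rewrite !big_nil; apply: lead_term_const.
by rewrite !big_cons; case: ifP => // Pi; apply: lead_termM; [apply: gk|].
Qed.

Lemma lead_termD g h k c d :
  lead_term g k c -> lead_term h k d -> lead_term (g + h) k (c + d).
Proof.
by move=> [g1 -> <-] [h1 -> <-]; exists (g1 + h1); rewrite ?mulrDr ?rmorphD.
Qed.

Lemma lead_termN g k c : lead_term g k c -> lead_term (- g) k (- c).
Proof. by move=> [g1 -> <-]; exists (- g1); rewrite ?mulrN ?rmorphN. Qed.

Lemma lead_termB g h k c d :
  lead_term g k c -> lead_term h k d -> lead_term (g - h) k (c - d).
Proof. by move=> gk hk; apply/lead_termD/lead_termN. Qed.

Lemma lead_term_lt g k l c : lead_term g k c -> (l < k)%N -> lead_term g l 0.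
Proof.
move=> [h -> _] lk; exists (fpsT ^+ (k - l) * h).
  by rewrite mulrA -exprD subnKC // ltnW.
by rewrite rmorphM rmorphXn /= fps_constT expr0n subn_eq0 leqNgt lk mul0r.
Qed.

Lemma lead_term_inj g k c d : lead_term g k c -> lead_term g k d -> c = d.
Proof. by move=> /lead_termP[_ <-] /lead_termP[]. Qed.

Lemma lead_term0 k : lead_term 0 k 0.
Proof. by exists 0; rewrite ?mulr0. Qed.

Lemma lead_term_order g k l c d :
  c != 0 -> d != 0 -> lead_term g k c -> lead_term g l d -> k = l.
Proof.
move=> c0 d0 gk gl; case: (ltngtP k l) => // kl.
  by case/eqP: c0; apply: lead_term_inj gk _; apply: lead_term_lt gl kl.
by case/eqP: d0; apply: lead_term_inj gl _; apply: lead_term_lt gk kl.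
Qed.

Lemma lead_term_ex g : g != 0 -> exists k c, c != 0 /\ lead_term g k c.
Proof.
move=> g0; have ex : exists i, fps_coef g i != 0.
  apply: contrapT => nex; case/eqP: g0; apply: fpsP => i.
  by case: (eqVneq (fps_coef g i) 0) => [->|gi]; [case: i|case: nex; exists i].
exists (ex_minn ex), (fps_coef g (ex_minn ex)).
case: ex_minnP => k gk kmin; split=> //; apply/lead_termP; split=> // i ik.
by case: (eqVneq (fps_coef g i) 0) => // /kmin; rewrite leqNgt ik.
Qed.

(** A nonzero c forces k to be the order of [g]; this is how the factors of [Ver] are read off from
    leading terms. *)
Lemma lowcoef_lead_term g k c : c != 0 -> lead_term g k c -> lowcoef g = c.
Proof.
move=> c0 gk; rewrite /lowcoef; case: pselect => [ex|[]]; last first.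
  by exists k; case/lead_termP: gk => _ ->.
case: ex_minnP => l gl lmin; have [g0 gkc] := proj1 (lead_termP _ _ _) gk.
rewrite -gkc; congr fps_coef; apply/eqP; rewrite eqn_leq lmin ?gkc //=.
by rewrite leqNgt; apply/negP => /g0 gl0; rewrite gl0 eqxx in gl.
Qed.

End PowerSeries.

(** A nonzero constant term makes [h] a unit, so multiplying by [h] preserves the order of [g] and
    scales its leading coefficient by that constant. *)
Lemma lead_term_divr (R : fieldType) (g h : {fps R}) k c :
    fps_const h != 0 -> lead_term (g * h) k c ->
  lead_term g k (c / fps_const h).
Proof.
move=> h0 ghk; have [g0|/lead_term_ex[l [b [b0 gl]]]] := eqVneq g 0.
  rewrite g0 mul0r in ghk *.
  by rewrite (lead_term_inj ghk (lead_term0 _ _)) mul0r; apply: lead_term0.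
have := lead_termM gl (lead_term_const h); rewrite addn0 => ghl.
have bh0 : b * fps_const h != 0 by rewrite mulf_neq0.
have [c0|c0] := eqVneq c 0; last first.
  have kl := lead_term_order bh0 c0 ghl ghk; rewrite -kl in ghk *.
  by rewrite -(lead_term_inj ghl ghk) mulfK.
(* An order l <= k of [g] would give [g * h] the nonzero coefficient b h(0) at T^l, although its
   coefficients up to T^k vanish. *)
rewrite c0 mul0r; apply: lead_term_lt gl _; rewrite ltnNge; apply/negP => lk.
case/eqP: bh0; apply: lead_term_inj ghl _.
move: lk; rewrite leq_eqVlt => /predU1P[->|lk]; first by rewrite -c0.
exact: lead_term_lt ghk lk.
Qed.

Arguments fps_const {R} g : simpl never.

(** * Products over pairs and the discriminant of y^m - C *)

Lemma prod_neq_pairs (R : comNzRingType) (r : nat) (X : 'I_r -> 'I_r -> R) :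
  \prod_(i < r) \prod_(j < r | j != i) X i j =
  \prod_(i < r) \prod_(j < r | (i < j)%N) (X i j * X j i).
Proof.
transitivity (\prod_(i < r) (\prod_(j < r | (i < j)%N) X i j *
                             \prod_(j < r | (j < i)%N) X i j)).
  apply: eq_bigr => i _; rewrite (bigID (fun j : 'I_r => (i < j)%N)) /=.
  by congr (_ * _); apply: eq_bigl => j; rewrite -val_eqE /=; case: ltngtP.
rewrite big_split /= [X in _ * X](exchange_big_dep predT) //= -big_split /=.
by apply: eq_bigr => i _; rewrite big_split.
Qed.

Lemma derivM_root (R : comNzRingType) (p : {poly R}) (a : R) :
  (('X - a%:P) * p)^`().[a] = p.[a].
Proof. by rewrite derivM derivXsubC !hornerE subrr mul0r addr0. Qed.

Lemma prod_XsubC_roots_of (L : fieldType) (m : nat) (C : L) (c : 'I_m -> L) :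
    (0 < m)%N -> injective c -> (forall i, c i ^+ m = C) ->
  \prod_(i < m) ('X - (c i)%:P) = 'X^m - C%:P.
Proof.
move=> m0 c_inj cm.
have /all_roots_prod_XsubC : size ('X^m - C%:P) = (size (codom c)).+1.
  by rewrite size_codom card_ord size_XnsubC.
rewrite lead_coefXnsubC // scale1r => -> //; last first.
- rewrite uniq_rootsE; apply/injectiveP => //.
- by apply/allP => _ /codomP[i ->]; rewrite /root !hornerE cm subrr.
by rewrite /codom /image_mem big_map big_enum.
Qed.

(** The derivative of y^m - C at c_i is both m c_i^(m-1) and the product of the c_i - c_j over j <>
    i; multiply over i and use that the product of the c_i is C up to sign. The sign stays
    unspecified because it ends up in the constant c of the theorem. *)
Lemma disc_roots_of (L : fieldType) (m : nat) (C : L) (c : 'I_m -> L) :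
    (0 < m)%N -> injective c -> (forall i, c i ^+ m = C) ->
  exists b : nat, \prod_(i < m) \prod_(j < m | (i < j)%N) (c i - c j) ^+ 2 =
    (-1) ^+ b * m%:R ^+ m * C ^+ m.-1.
Proof.
move=> m0 c_inj cm; have pE := prod_XsubC_roots_of m0 c_inj cm.
have prodc : \prod_(i < m) c i = (-1) ^+ m.+1 * C.
  have := congr1 (horner^~ 0) pE; rewrite horner_prod !hornerE expr0n.
  rewrite eqn0Ngt m0 /= sub0r; under eq_bigr do rewrite hornerXsubC sub0r.
  rewrite prodrN card_ord => /(canRL (signrMK m)) ->.
  by rewrite exprS mulN1r mulNr mulrN.
have E : \prod_(i < m) \prod_(j < m | j != i) (c i - c j) =
         \prod_(i < m) (m%:R * c i ^+ m.-1).
  apply: eq_bigr => i _; have := congr1 (fun p => p^`().[c i]) pE.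
  rewrite (bigD1 i) //= derivM_root horner_prod derivB derivXn derivC subr0.
  rewrite hornerMn hornerXn mulr_natl => <-.
  by apply: eq_bigr => j _; rewrite !hornerE.
rewrite prod_neq_pairs in E.
have pairE (i j : 'I_m) : (c i - c j) * (c j - c i) = - 1 * (c i - c j) ^+ 2.
  by ring.
(* One sign for each pair i < j, from (c_i - c_j)(c_j - c_i), and (m+1)(m-1) signs from the (m-1)-th
   power of prod c_i = (-1)^(m+1) C. *)
exists (\sum_(i < m) #|[pred j : 'I_m | (i < j)%N]| + m.+1 * m.-1)%N.
rewrite exprD exprM -[LHS](signrMK (\sum_(i < m) #|[pred j : 'I_m | (i < j)%N]|)).
rewrite -!mulrA; congr (_ * _); rewrite mulrCA -exprMn -prodc -prodrXl.
transitivity (\prod_(i < m) (m%:R * c i ^+ m.-1)); last first.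
  by rewrite big_split /= prodr_const card_ord.
rewrite -E -prodrXr -big_split; apply: eq_bigr => i _ /=.
rewrite -prodr_const -big_split /=; apply: eq_bigr => j _.
by rewrite pairE.
Qed.

(** * Orders and leading coefficients of differences of t-roots *)

Lemma fps_const_horner (R : comNzRingType) (p : {poly {fps R}}) (x : {fps R}) :
  fps_const p.[x] = (map_poly (@fps_const R) p).[fps_const x].
Proof. by rewrite horner_map. Qed.

Lemma lead_term_horner (R : comNzRingType) (p : {poly {fps R}}) (x : {fps R}) k :
  lead_term (fpsT ^+ k * p.[x]) k (map_poly (@fps_const R) p).[fps_const x].
Proof. by apply: lead_termT; rewrite fps_const_horner. Qed.

(* Here c i is the leading coefficient of G(s i), divided by G'(a). *)
Lemma root_separation (L : fieldType) (m K : nat) (a : L)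
    (F al de G E H : {poly {fps L}}) (s : 'I_m -> {fps L})
    (ev := fun p : {poly {fps L}} => (map_poly (@fps_const L) p).[a]) :
    m%:R != 0 :> L -> (0 < K)%N ->
    al * F = G ^+ m + (fpsT ^+ K)%:P * de + (fpsT ^+ K.+1)%:P * E ->
    F = H * \prod_(i < m) ('X - (s i)%:P) ->
    (forall i, fps_const (s i) = a) ->
    ev G^`() != 0 -> ev H != 0 -> ev al != 0 -> ev de != 0 ->
  exists e (c : 'I_m -> L),
    [/\ (m * e)%N = K, injective c, forall i, c i ^+ m = - ev de / ev G^`() ^+ m
      & forall i j, lead_term (s i - s j) e (c i - c j)].
Proof.
move=> m0 K0 idF FE sa G'0 H0 al0 de0.
have mgt0 : (0 < m)%N by rewrite lt0n; apply: contraNneq m0 => ->.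
have Fi i : F = ('X - (s i)%:P) *
    (H * \prod_(j < m | j != i) ('X - (s j)%:P)).
  by rewrite FE (bigD1 i) //= mulrCA.
have Fs0 i : F.[s i] = 0 by rewrite (Fi i) hornerM hornerXsubC subrr mul0r.
(* [F] vanishes at s_i, so there G(s_i)^m = - T^K de(s_i) + O(T^(K+1)). *)
have Gm i : lead_term (G.[s i] ^+ m) K (- ev de).
  have := congr1 (horner^~ (s i)) idF.
  rewrite hornerM 2!hornerD horner_exp !hornerCM Fs0 mulr0.
  move=> /esym/eqP; rewrite -addrA addr_eq0 => /eqP ->.
  rewrite -[ev de]addr0; apply: lead_termN; apply: lead_termD.
    by have := lead_term_horner de (s i) K; rewrite sa.
  exact: lead_term_lt (lead_term_horner E (s i) K.+1) (ltnSn K).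
have Gord i : exists e c, [/\ (m * e)%N = K, c ^+ m = - ev de & lead_term G.[s i] e c].
  have [G0|/lead_term_ex[e [c [c0 Gec]]]] := eqVneq G.[s i] 0.
    have := Gm i; rewrite G0 expr0n eqn0Ngt mgt0 /=.
    move=> /(lead_term_inj (lead_term0 _ K))/eqP.
    by rewrite eq_sym oppr_eq0 (negPf de0).
  have Gmec := lead_termX m Gec.
  have eK : (m * e)%N = K.
    by apply: lead_term_order Gmec (Gm i); rewrite ?oppr_eq0 ?expf_neq0.
  exists e, c; split=> //; rewrite eK in Gmec; exact: lead_term_inj Gmec (Gm i).
(* The relation m e = K makes the order of G(s_i) the same for every i. *)
set e := (K %/ m)%N; pose g i := fps_coef G.[s i] e.
have Gg i : [/\ (m * e)%N = K, g i ^+ m = - ev de & lead_term G.[s i] e (g i)].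
  have [e1 [c [eK cm Gec]]] := Gord i.
  have -> : e = e1 by rewrite /e -eK mulKn.
  have -> : g i = c.
    by have [_ <-] := proj1 (lead_termP _ _ _) Gec; rewrite /g /e -eK mulKn.
  by split.
have meK : (m * e)%N = K by have [] := Gg (Ordinal mgt0).
have e0 : (0 < e)%N by move: K0; rewrite -meK muln_gt0 => /andP[].
set ga := ev G^`() in G'0 *; pose c i := g i / ga.
(* G(s_i) - G(s_j) = (s_i - s_j) q(s_i), where q(s_i) has constant term G'(a) because s_i and s_j
   both have constant term a. *)
have sc i j : lead_term (s i - s j) e (c i - c j).
  have [q qE] : exists q, G - (G.[s j])%:P = q * ('X - (s j)%:P).
    by apply/factor_theorem; rewrite /root hornerD hornerN hornerC subrr.
  have qa : fps_const q.[s i] = ga.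
    rewrite /ga /ev; have -> : G^`() = (G - (G.[s j])%:P)^`().
      by rewrite derivB derivC subr0.
    rewrite qE derivM derivXsubC mulr1 rmorphD rmorphM rmorphB /= map_polyX.
    rewrite map_polyC /= sa hornerD hornerM hornerXsubC subrr mulr0 add0r.
    by rewrite fps_const_horner sa.
  rewrite /c -mulrBl -qa; apply: lead_term_divr; first by rewrite qa.
  have -> : (s i - s j) * q.[s i] = G.[s i] - G.[s j].
    have := congr1 (horner^~ (s i)) qE.
    by rewrite hornerD hornerN hornerC hornerM hornerXsubC mulrC.
  by apply: lead_termB; [have [] := Gg i|have [] := Gg j].
exists e, c; split=> //; last first.
  by move=> i; rewrite expr_div_n; have [_ ->] := Gg i.
move=> i j cij; apply/eqP; case: eqVneq => // ij; exfalso.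
(* Differentiate the decomposition in x at s_i and compare coefficients of T^(e(m-1)). The terms in
   T^K and T^(K+1) drop out since K = m e exceeds e(m-1). *)
have : ev al * ev H * \prod_(j < m | j != i) (c i - c j) =
       ga * g i ^+ m.-1 *+ m.
  have := congr1 (fun p => p^`().[s i]) idF.
  rewrite derivM hornerD !hornerM Fs0 mulr0 add0r {1}(Fi i) derivM_root.
  rewrite hornerM horner_prod; under eq_bigr do rewrite hornerXsubC.
  rewrite 2!derivD !deriv_mulC deriv_exp 2!hornerD hornerMn !hornerCM hornerM.
  rewrite horner_exp => idE.
  have lhs : lead_term (al.[s i] * (H.[s i] * \prod_(j < m | j != i) (s i - s j)))
      (e * m.-1) (ev al * ev H * \prod_(j < m | j != i) (c i - c j)).
    rewrite -mulrA -[(e * m.-1)%N]add0n -[(0 + _)%N]add0n; apply: lead_termM.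
      by have := lead_term_const al.[s i]; rewrite fps_const_horner sa.
    apply: lead_termM.
      by have := lead_term_const H.[s i]; rewrite fps_const_horner sa.
    have := lead_term_prod (index_enum _) (fun j (_ : j != i) => sc i j).
    by rewrite sum_nat_const cardC1 card_ord mulnC.
  have small p k : (K <= k)%N -> lead_term (fpsT ^+ k * p.[s i]) (e * m.-1) 0.
    move=> Kk; apply: lead_term_lt (lead_term_horner p (s i) k) _.
    by apply: leq_trans Kk; rewrite -meK mulnC ltn_pmul2r // prednK.
  apply: lead_term_inj lhs _; rewrite idE -[ga * _ *+ m]addr0 -[_ *+ m + 0]addr0.
  apply: lead_termD; last exact: small.
  apply: lead_termD; last exact: small.
  rewrite -[X in lead_term X]mulr_natr -[X in lead_term _ _ X]mulr_natr.
  rewrite -[(e * m.-1)%N]addn0; apply: lead_termM; last first.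
    by have := lead_term_const (m%:R : {fps L}); rewrite rmorph_nat.
  rewrite -[(e * m.-1)%N]add0n; apply: lead_termM.
    by have := lead_term_const (G^`()).[s i]; rewrite fps_const_horner sa.
  by rewrite mulnC; apply: lead_termX; have [] := Gg i.
(* The product contains c_i - c_j = 0, so g_i = 0 as m is nonzero in [L]; this contradicts g_i^m = -
   de(a). *)
rewrite (bigD1 j) 1?eq_sym //= cij subrr mul0r mulr0 -mulr_natr => /esym/eqP.
rewrite !mulf_eq0 (negPf G'0) (negPf m0) orbF /= expf_eq0 => /andP[_ gi0].
have [_] := Gg i; rewrite (eqP gi0) expr0n eqn0Ngt mgt0 => /esym/eqP.
by rewrite oppr_eq0 (negPf de0).
Qed.

(** * From families over A to polynomials over L[[T]] *)

Section FamilyExpansion.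
Variables (A : idomainType) (L : closedFieldType) (j : {rmorphism A -> L}).
Variables (n' N : nat).
Hypothesis N_gt0 : (0 < N)%N.

Lemma fps_ramify_shift (g : {fps A}) :
  fps_ramify j N g =
    fpsC (j (fps_coef g 0)) + fpsT ^+ N * fps_ramify j N (fps_shift 1 g).
Proof.
apply: fpsP => i.
transitivity (fps_coef (fpsC (j (fps_coef g 0))) i +
              fps_coef (fpsT ^+ N * fps_ramify j N (fps_shift 1 g)) i) => //.
rewrite fps_coefTnM; case: ltnP => [iN|Ni].
  case: i iN => [|i] iN /=; first by rewrite dvdn0 div0n addr0.
  by rewrite addr0 (gtnNdvd _ iN).
have -> : fps_coef (fpsC (j (fps_coef g 0))) i = 0.
  by case: i Ni => //; rewrite leqNgt N_gt0.
rewrite add0r /= -{1 2}(subnKC Ni) dvdn_addr // divnDl // divnn N_gt0.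
by case: ifP.
Qed.

(** One Taylor step in t = T^N. The size bound ensures that [family_xpoly] cuts nothing off F_0. *)
Lemma family_xpolyL_shift (F : {fps {poly A}}) :
    (size (fps_coef F 0) <= n'.+1)%N ->
  family_xpolyL j n' N F = map_poly (@fpsC L \o j) (fps_coef F 0) +
    (fpsT ^+ N)%:P * family_xpolyL j n' N (fps_shift 1 F).
Proof.
have ram0 : fps_ramify j N 0 = 0.
  have coef0 (R : comNzRingType) i : fps_coef (0 : {fps R}) i = 0 by case: i.
  apply: fpsP => i; rewrite coef0.
  transitivity (if (N %| i)%N then j (fps_coef 0 (i %/ N)) else 0) => //.
  by rewrite coef0 rmorph0 if_same.
move=> szF; apply/polyP => i; rewrite coefD coefCM !coef_map_id0 ?rmorph0 //=.
rewrite !coef_poly; case: ltnP => [_|ni]; first exact: fps_ramify_shift.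
by rewrite (nth_default 0 (leq_trans szF ni)) ram0 !rmorph0 mulr0 addr0.
Qed.

(** The outer variable of [p] is t, replaced by T^N, and the inner one is x. As a ring morphism it
    carries polynomial identities over to L[[T]]. *)
Definition eval_family (p : {poly {poly A}}) : {poly {fps L}} :=
  (map_poly (map_poly (@fpsC L \o j)) p).[(fpsT ^+ N)%:P].

Fact eval_family_is_zmod_morphism : zmod_morphism eval_family.
Proof. by move=> p q; rewrite /eval_family rmorphB hornerD hornerN. Qed.

Fact eval_family_is_monoid_morphism : monoid_morphism eval_family.
Proof.
split=> [|p q]; first by rewrite /eval_family rmorph1 hornerC.
by rewrite /eval_family rmorphM hornerM.
Qed.

HB.instance Definition _ := GRing.isZmodMorphism.Build
  {poly {poly A}} {poly {fps L}} eval_family eval_family_is_zmod_morphism.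
HB.instance Definition _ := GRing.isMonoidMorphism.Build
  {poly {poly A}} {poly {fps L}} eval_family eval_family_is_monoid_morphism.

Lemma eval_familyC p : eval_family p%:P = map_poly (@fpsC L \o j) p.
Proof. by rewrite /eval_family map_polyC hornerC. Qed.

Lemma eval_familyX : eval_family 'X = (fpsT ^+ N)%:P.
Proof. by rewrite /eval_family map_polyX hornerX. Qed.

(** Each Taylor step peels off one coefficient of [F] and gives the remainder another factor T^N. *)
Lemma family_xpolyL_trunc n (F : {fps {poly A}}) :
    (forall i, (size (fps_coef F i) <= n'.+1)%N) ->
  exists E, family_xpolyL j n' N F =
    eval_family (fps_trunc n F) + (fpsT ^+ (N * n.+1))%:P * E.
Proof.
elim: n F => [|n IHn] F szF.
  exists (family_xpolyL j n' N (fps_shift 1 F)).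
  rewrite family_xpolyL_shift // muln1; congr (_ + _).
  rewrite -eval_familyC; congr eval_family.
  by apply/polyP => -[|i]; rewrite coef_poly coefC.
have [i|E EE] := IHn (fps_shift 1 F); first exact: szF.
exists E; rewrite family_xpolyL_shift // EE -eval_familyC -eval_familyX.
rewrite mulrDr mulrA -rmorphM addrA -rmorphD /= eval_familyX -polyCM -exprD -mulnS.
congr (eval_family _ + _); apply/polyP => i; rewrite coefD coefXM coefC.
by rewrite !coef_poly; case: i => [|i] /=; rewrite ?addr0 ?add0r ?ltnS.
Qed.

(** Modulo t^(n+1) the decomposition is an identity of polynomials in t, which [eval_family]
    transports. At T = 0 only f beta_0 survives in G, so b is the image of beta_0. *)
Lemma Zd_eval (F : {fps {poly A}}) f m n al de :
    (forall i, (size (fps_coef F i) <= n'.+1)%N) -> Zd F f m n al de ->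
  exists (G E : {poly {fps L}}) (b : {poly L}),
    map_poly (@fpsC L \o j) al * family_xpolyL j n' N F =
      G ^+ m + (fpsT ^+ (N * n))%:P * map_poly (@fpsC L \o j) de +
      (fpsT ^+ (N * n).+1)%:P * E /\
    map_poly (@fps_const L) G = map_poly j f * b.
Proof.
move=> szF [m_gt1 n_gt0 _ [beta [rest ZdE]]].
have [G GE] : exists G : {poly {poly A}},
    G = (f * beta 0%N)%:P + \sum_(1 <= i < n) (beta i)%:P * 'X^i by eexists.
have [Y YE] : exists Y, al%:P * fps_trunc n F = G ^+ m + de%:P * 'X^n + 'X^(n.+1) * Y.
  (* [D] has no coefficients below t^(n+1); dividing it by t^(n+1) gives the required Y. *)
  pose D := al%:P * fps_trunc n F - (G ^+ m + de%:P * 'X^n).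
  have D0 : take_poly n.+1 D = 0.
    apply/polyP => i; rewrite coef_take_poly coef0; case: ltnP => // lt_in.
    rewrite /D coefB; apply/eqP; rewrite subr_eq0; apply/eqP.
    have := congr1 (fun g => fps_coef g i) ZdE.
    have -> : fps_coef (fpsC al * F) i = (al%:P * fps_trunc n F)`_i.
      rewrite coefCM coef_fps_trunc //= big_ord_recl subn0 big1 ?addr0 // => k _.
      exact: mul0r.
    have -> : (fpsC (f * beta 0%N) +
        \sum_(1 <= i < n) fpsC (beta i) * fpsT ^+ i) ^+ m + fpsC de * fpsT ^+ n =
        fps_of_poly (G ^+ m + de%:P * 'X^n).
      rewrite rmorphD rmorphXn /= fps_of_poly_monomial GE rmorphD rmorph_sum /=.
      rewrite fps_of_polyC; congr ((_ + _) ^+ _ + _).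
      by apply: eq_bigr => k _; rewrite fps_of_poly_monomial.
    move=> ->; rewrite [X in _ + X]mulrC.
    have -> (g h : {fps {poly A}}) : fps_coef (g + h) i = fps_coef g i + fps_coef h i.
      by [].
    by rewrite fps_coefTnM lt_in addr0.
  exists (drop_poly n.+1 D).
  by rewrite ['X^_ * _]mulrC -[drop_poly _ _ * _]add0r -D0 poly_take_drop /D addrC subrK.
have [E EE] := family_xpolyL_trunc n szF.
(* Both remainders carry T^(N(n+1)), and N(n+1) = (N n + 1) + (N - 1), whence the T^(N-1) in the
   witness. *)
exists (eval_family G),
  ((fpsT ^+ N.-1)%:P * (eval_family Y + map_poly (@fpsC L \o j) al * E)),
  (map_poly j (beta 0%N)).
have consteval p : map_poly (@fps_const L) (map_poly (@fpsC L \o j) p) = map_poly j p.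
  by rewrite -map_poly_comp; apply: eq_map_poly => x /=; rewrite fps_constC.
split.
  have := congr1 eval_family YE; rewrite !rmorphD !rmorphM !rmorphXn /= !eval_familyC.
  rewrite eval_familyX -!polyC_exp -!exprM => YL.
  rewrite EE mulrDr YL mulrC.
  have -> : (N * n.+1 = (N * n).+1 + N.-1)%N by rewrite mulnS addSnnS prednK // addnC.
  rewrite exprD polyCM; ring.
rewrite GE rmorphD /= eval_familyC rmorph_sum /= rmorphD /= consteval.
rewrite rmorph_sum /= big1_seq.
  by rewrite addr0 rmorphM.
move=> i /andP[_]; rewrite mem_index_iota => /andP[i_gt0 _].
rewrite rmorphM rmorphXn /= eval_familyX rmorphM rmorphXn /= map_polyC /=.
by rewrite rmorphXn /= fps_constT !expr0n eqn0Ngt N_gt0 polyC0 expr0n eqn0Ngt i_gt0 mulr0.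
Qed.
End FamilyExpansion.

(** [exists c, lead_term (x - y) e c] encodes x = y modulo T^e, and such congruences multiply. *)
Lemma lead_term_prodB (R : comNzRingType) (I : Type) (r : seq I) (P : pred I)
    (g h : I -> {fps R}) e :
    (forall i, P i -> exists c, lead_term (g i - h i) e c) ->
  exists c, lead_term (\prod_(i <- r | P i) g i - \prod_(i <- r | P i) h i) e c.
Proof.
move=> gh; apply: (big_ind2 (fun x y => exists c, lead_term (x - y) e c)) => //.
  by exists 0; rewrite subrr; apply: lead_term0.
move=> x1 x2 y1 y2 [c xc] [c1 yc].
exists (c * fps_const y1 + c1 * fps_const x2).
have -> : x1 * y1 - x2 * y2 = (x1 - x2) * y1 + (y1 - y2) * x2 by ring.
by apply: lead_termD; rewrite -[e]addn0; apply: lead_termM => //; apply: lead_term_const.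
Qed.

(** * Reduction at T = 0 near a root of f_nu *)

Section DiscriminantAtRoot.
Variables (A : idomainType) (L : closedFieldType) (j : {rmorphism A -> L}).
Variables (n' r N : nat) (F : {fps {poly A}}).
Variables (f : 'I_r -> {poly A}) (d mult : 'I_r -> nat).
Variable a : forall nu : 'I_r, 'I_(d nu) -> L.
Variable s : forall nu : 'I_r, 'I_(d nu) -> 'I_(mult nu) -> {fps L}.
Hypothesis hF : is_family n' F.
Hypothesis hF0 : fps_coef F 0 = \prod_(nu < r) f nu ^+ mult nu.
Hypothesis f_monic : forall nu, f nu \is monic.
Hypothesis f_roots : forall nu,
  map_poly j (f nu) = \prod_(l < d nu) ('X - (a l)%:P).
Hypothesis a_inj :
  injective (fun p : {nu : 'I_r & 'I_(d nu)} => a (tagged p)).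
Hypothesis hs : is_troots j n' N F a s.

Local Notation fL nu := (map_poly j (f nu)).
Local Notation FL := (family_xpolyL j n' N F).
Local Notation cst := (map_poly (@fps_const L)).
Local Notation fpsCj := (map_poly (@fpsC L \o j)).

Lemma family_size i : (size (fps_coef F i) <= n'.+1)%N.
Proof. by case: hF => F0 Fi; case: i => [|i]; [rewrite F0 | apply: Fi]. Qed.

(** As F_0 is monic of degree n', the coefficient of x^n' in [F] is 1 at t = 0; being nonzero, it is
    the leading coefficient. *)
Lemma const_family_lead : fps_const (family_lead j n' N F) = 1.
Proof.
have F0n : (fps_coef F 0)`_n' = 1.
  have /monicP : fps_coef F 0 \is monic.
    by rewrite hF0; apply: monic_prod => nu _; apply: monic_exp.
  by rewrite lead_coefE (proj1 hF).
have neq0 : Fps (fun i => (fps_coef F i)`_n') != 0.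
  apply/eqP => /(congr1 (fun g => fps_coef g 0)) /= /eqP.
  by rewrite F0n oner_eq0.
rewrite /family_lead /family_xpoly lead_coef_poly // /fps_const /= dvdn0 div0n.
by rewrite F0n rmorph1.
Qed.

Lemma const_root (nu : 'I_r) (l : 'I_(d nu)) i : fps_const (s l i) = a l.
Proof. by case: hs => _ _; apply. Qed.

Lemma const_factor (nu : 'I_r) (l : 'I_(d nu)) i :
  cst ('X - (s l i)%:P) = 'X - (a l)%:P.
Proof. by rewrite rmorphB /= map_polyX map_polyC /= const_root. Qed.

Lemma const_block (nu : 'I_r) :
  cst (\prod_(l < d nu) \prod_(i < mult nu) ('X - (s l i)%:P)) = fL nu ^+ mult nu.
Proof.
rewrite rmorph_prod f_roots -prodrXl; apply: eq_bigr => l _ /=.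
rewrite rmorph_prod /=; under eq_bigr do rewrite const_factor.
by rewrite prodr_const card_ord.
Qed.

Lemma const_FL : cst FL = \prod_(nu < r) fL nu ^+ mult nu.
Proof.
case: hs => _ -> _; rewrite -mul_polyC rmorphM /= map_polyC /= const_family_lead.
rewrite mul1r rmorph_prod /=; apply: eq_bigr => nu _; exact: const_block.
Qed.

Lemma f_root (nu : 'I_r) (l : 'I_(d nu)) : (fL nu).[a l] = 0.
Proof. by rewrite f_roots (bigD1 l) //= hornerM hornerXsubC subrr mul0r. Qed.

Lemma f_nonroot (nu nu1 : 'I_r) (l : 'I_(d nu)) :
  nu1 != nu -> (fL nu1).[a l] != 0.
Proof.
move=> nu1P; rewrite f_roots horner_prod; apply/prodf_neq0 => l1 _.
rewrite hornerXsubC subr_eq0; apply: contra nu1P => /eqP al.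
have := @a_inj (Tagged (fun nu => 'I_(d nu)) l) (Tagged (fun nu => 'I_(d nu)) l1) al.
by move=> /(congr1 (@tag _ _)) /= ->.
Qed.

Lemma a_injl (nu : 'I_r) (l l1 : 'I_(d nu)) : a l = a l1 -> l = l1.
Proof.
move=> al.
have := @a_inj (Tagged (fun nu => 'I_(d nu)) l) (Tagged (fun nu => 'I_(d nu)) l1) al.
by move=> /eqP; rewrite eq_Tagged => /eqP.
Qed.

(** The value at x of F_0 / f_nu^(n_nu). *)
Definition cofactor_at (nu : 'I_r) (x : L) : L :=
  \prod_(nu1 < r | nu1 != nu) (fL nu1).[x] ^+ mult nu1.

Lemma cofactor_at_neq0 (nu : 'I_r) (l : 'I_(d nu)) : cofactor_at nu (a l) != 0.
Proof. by apply/prodf_neq0 => nu1 P; rewrite expf_neq0 // f_nonroot. Qed.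

(** The condition f_nu(s(0)) <> 0 in [tcofactor] retains exactly the blocks of the indices other
    than nu. *)
Lemma const_tcofactor (nu : 'I_r) (l : 'I_(d nu)) :
  fps_const (tcofactor j n' N F f s nu).[fpsC (a l)] = cofactor_at nu (a l).
Proof.
rewrite fps_const_horner fps_constC /tcofactor -mul_polyC rmorphM /= map_polyC /=.
rewrite const_family_lead mul1r rmorph_prod /= horner_prod /cofactor_at.
rewrite [RHS]big_mkcond /=; apply: eq_bigr => nu1 _.
have [->|nu1P] := eqVneq nu1 nu; last first.
  rewrite -horner_exp -const_block; congr (cst _).[_].
  apply: eq_bigr => l1 _; apply: eq_bigl => i.
  by rewrite -/(fps_const _) const_root f_nonroot // eq_sym.
rewrite big1 ?rmorph1 ?hornerC // => l1 _; apply: big_pred0 => i.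
by rewrite -/(fps_const _) const_root f_root eqxx.
Qed.

(** This is f_nu'(a_l), the ratio of s'_i - s'_j at a_l to s_i - s_j to leading order. *)
Definition sep_at (nu : 'I_r) (l : 'I_(d nu)) : L :=
  \prod_(l1 < d nu | l1 != l) (a l - a l1).

Lemma sep_at_neq0 (nu : 'I_r) (l : 'I_(d nu)) : sep_at l != 0.
Proof.
apply/prodf_neq0 => l1 l1l; rewrite subr_eq0; apply: contra l1l => /eqP al.
by rewrite (a_injl al).
Qed.

Lemma deriv_f_root (nu : 'I_r) (l : 'I_(d nu)) : (fL nu)^`().[a l] = sep_at l.
Proof.
rewrite f_roots (bigD1 l) //= derivM_root horner_prod.
by apply: eq_bigr => l1 _; rewrite hornerXsubC.
Qed.

Lemma family_factor (nu : 'I_r) (l : 'I_(d nu)) : exists2 H : {poly {fps L}},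
  FL = H * \prod_(i < mult nu) ('X - (s l i)%:P) & (cst H).[a l] != 0.
Proof.
exists (family_lead j n' N F *:
  ((\prod_(l1 < d nu | l1 != l) \prod_(i < mult nu) ('X - (s l1 i)%:P)) *
   \prod_(nu1 < r | nu1 != nu) \prod_(l1 < d nu1) \prod_(i < mult nu1)
     ('X - (s l1 i)%:P))).
  case: hs => _ -> _; rewrite (bigD1 nu) //= (bigD1 l) //= -scalerAl.
  by congr (_ *: _); ring.
rewrite -mul_polyC 2!rmorphM /= map_polyC /= const_family_lead mul1r hornerM.
rewrite mulf_neq0 // rmorph_prod /= horner_prod; apply/prodf_neq0.
  move=> l1 l1l; rewrite rmorph_prod /= horner_prod; apply/prodf_neq0 => i _.
  rewrite const_factor hornerXsubC subr_eq0; apply: contra l1l => /eqP al.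
  by rewrite (a_injl al).
by move=> nu1 nu1P; rewrite const_block horner_exp expf_neq0 // f_nonroot.
Qed.

(** * The discriminant at a root under the Zeuthen condition *)

Section Zeuthen.
Variables (nu : 'I_r) (n : nat) (al de : {poly A}).
Hypothesis zd : Zd F (f nu) (mult nu) n al de.
Hypothesis mult_neq0 : (mult nu)%:R != 0 :> L.
Hypothesis al_neq0 : forall l : 'I_(d nu), (map_poly j al).[a l] != 0.
Hypothesis de_neq0 : forall l : 'I_(d nu), (map_poly j de).[a l] != 0.

(** Take v_i = f_nu'(a) c_i with the c_i of [root_separation]: since G'(a) = f_nu'(a) b(a), the
    factor f_nu'(a) cancels in v_i^m. A single e for all roots of f_nu is what the comparison of the
    s'_i uses. *)
Lemma Zd_roots : exists2 e, (0 < e)%N &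
  forall l : 'I_(d nu), exists v : 'I_(mult nu) -> L,
    [/\ injective v,
        forall i, v i ^+ mult nu =
          - ((map_poly j de).[a l] / (map_poly j al).[a l]) / cofactor_at nu (a l)
      & forall i i1, lead_term (s l i - s l i1) e ((v i - v i1) / sep_at l)].
Proof.
have N0 : (0 < N)%N by case: hs.
have n0 : (0 < n)%N by case: zd.
have m0 : (0 < mult nu)%N by case: zd => /ltnW.
have [G [E [b [idG cG]]]] := Zd_eval j N0 family_size zd.
have K0 : (0 < N * n)%N by rewrite muln_gt0 N0.
have constCj p : cst (fpsCj p) = map_poly j p.
  by rewrite -map_poly_comp; apply: eq_map_poly => x /=; rewrite fps_constC.
(* At T = 0 the decomposition reads al F_0 = (f_nu b)^m; cancel f_nu^m. *)
have bE : map_poly j al * \prod_(nu1 < r | nu1 != nu) fL nu1 ^+ mult nu1 =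
          b ^+ mult nu.
  have := congr1 cst idG; rewrite rmorphM 2!rmorphD rmorphXn 2!rmorphM /= cG.
  rewrite !map_polyC /= !rmorphXn /= fps_constT !expr0n eqn0Ngt K0 /= !mul0r !addr0.
  rewrite constCj const_FL (bigD1 nu) //= exprMn mulrCA => /mulfI; apply.
  by rewrite expf_neq0 // monic_neq0 // monic_map.
have baE (l : 'I_(d nu)) :
    b.[a l] ^+ mult nu = (map_poly j al).[a l] * cofactor_at nu (a l).
  rewrite -horner_exp -bE hornerM horner_prod; congr (_ * _).
  by apply: eq_bigr => nu1 _; rewrite horner_exp.
have ba0 (l : 'I_(d nu)) : b.[a l] != 0.
  apply: contra_neq (mulf_neq0 (al_neq0 l) (cofactor_at_neq0 l)) => b0.
  by rewrite -baE b0 expr0n eqn0Ngt m0.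
have G'E (l : 'I_(d nu)) : (cst G^`()).[a l] = sep_at l * b.[a l].
  rewrite -deriv_map cG derivM hornerD !hornerM f_root mul0r addr0.
  by rewrite deriv_f_root.
(* The order is N n / m. The form [.-1.+1] makes it positive even if f_nu has no root, and changes
   nothing once a root exists. *)
exists (N * n %/ mult nu).-1.+1%N; first by [].
move=> l; have [H FH H0] := family_factor l.
have [||||e [c [eK c_inj cm sc]]] := root_separation mult_neq0 K0 idG FH (const_root l).
- by rewrite G'E mulf_neq0 ?sep_at_neq0.
- exact: H0.
- by rewrite constCj al_neq0.
- by rewrite constCj de_neq0.
have e0 : (0 < e)%N by move: K0; rewrite -eK muln_gt0 => /andP[].
rewrite -eK mulKn // prednK //; exists (fun i => sep_at l * c i).
split=> [i i1 /(mulfI (sep_at_neq0 l))/c_inj //|i|i i1].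
  rewrite exprMn cm constCj G'E exprMn baE.
  have S0 : sep_at l ^+ mult nu != 0 by rewrite expf_neq0 ?sep_at_neq0.
  move: (sep_at l ^+ _) S0 (al_neq0 l) (cofactor_at_neq0 l) => S S0 al0 co0.
  by field; rewrite S0 al0 co0.
by rewrite -mulrBr mulrC mulKf // sep_at_neq0.
Qed.

(** At x = a_l one has s'_i = - X_i R_i, with X_i = a_l - s_i of positive order and R_i(0) =
    f_nu'(a_l). In s'_i - s'_j = (s_i - s_j) R_i + X_j (R_j - R_i) the last term has order above e.
    At the other roots only congruence modulo T^e enters, so the labelling there is immaterial. *)
Lemma tconjB_lead e (l : 'I_(d nu)) (v : 'I_(mult nu) -> L) : (0 < e)%N ->
    (forall l1 i i1, exists c, lead_term (s (nu := nu) l1 i - s l1 i1) e c) ->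
    (forall i i1, lead_term (s l i - s l i1) e ((v i - v i1) / sep_at l)) ->
  forall i i1, lead_term ((tconj j f s i - tconj j f s i1).[fpsC (a l)]) e
    (v i - v i1).
Proof.
move=> e0 se sv i i1; pose X (l1 : 'I_(d nu)) (i : 'I_(mult nu)) := fpsC (a l) - s l1 i.
pose R i := \prod_(l1 < d nu | l1 != l) X l1 i.
have constR k : fps_const (R k) = sep_at l.
  rewrite rmorph_prod; apply: eq_bigr => l1 _.
  by rewrite rmorphB /= fps_constC const_root.
have tE k : (tconj j f s k).[fpsC (a l)] = - (X l k * R k).
  rewrite hornerD hornerN horner_map /= f_root rmorph0 add0r horner_prod.
  by rewrite (bigD1 l) //= hornerXsubC; under eq_bigr do rewrite hornerXsubC.
have [c Rc] : exists c, lead_term (R i1 - R i) e c.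
  apply: lead_term_prodB => l1 _; have [c lc] := se l1 i i1; exists c.
  by have -> : X l1 i1 - X l1 i = s l1 i - s l1 i1 by rewrite /X; ring.
have X1 : lead_term (X l i1) 1 (fps_coef (X l i1) 1).
  apply/lead_termP; split=> // -[] // _.
  have : fps_const (X l i1) = 0 by rewrite rmorphB /= fps_constC const_root subrr.
  by [].
rewrite hornerD hornerN !tE.
have -> : - (X l i * R i) - - (X l i1 * R i1) =
    (s l i - s l i1) * R i + X l i1 * (R i1 - R i) by rewrite /X; ring.
rewrite -[v i - v i1]addr0; apply: lead_termD.
  have := lead_termM (sv i i1) (lead_term_const (R i)).
  by rewrite addn0 constR divfK ?sep_at_neq0.
by apply: lead_term_lt (lead_termM X1 Rc) _; rewrite add1n.
Qed.

(** With q the cofactor and D = de/al at a_l, Q_nu contributes q^(2m-2) and the discriminant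
    (-D/q)^(m-1) up to sign and m^m; together they give (D q)^(m-1). *)
Lemma Zd_lowcoef_disc (l : 'I_(d nu)) : exists b : nat,
  lowcoef (gen_disc j n' N F f s nu).[fpsC (a l)] =
    (-1) ^+ b * (mult nu)%:R ^+ mult nu *
    ((map_poly j de).[a l] / (map_poly j al).[a l] * cofactor_at nu (a l))
      ^+ (mult nu).-1.
Proof.
have m0 : (0 < mult nu)%N by case: zd => /ltnW.
have [e e0 sep] := Zd_roots.
have [v [v_inj vm sv]] := sep l.
have [b bE] := disc_roots_of m0 v_inj vm.
have tl : forall i i1, lead_term ((tconj j f s i - tconj j f s i1).[fpsC (a l)]) e
    (v i - v i1).
  apply: tconjB_lead => // l1 i i1; have [w [_ _ sw]] := sep l1.
  by exists ((w i - w i1) / sep_at l1).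
have [K disc_lead] : exists K,
    lead_term (gen_disc j n' N F f s nu).[fpsC (a l)] K
      (cofactor_at nu (a l) ^+ (2 * mult nu - 2) *
       \prod_(i < mult nu) \prod_(i1 < mult nu | (i < i1)%N) (v i - v i1) ^+ 2).
  rewrite /gen_disc hornerM horner_exp horner_prod.
  under eq_bigr do rewrite horner_prod.
  under eq_bigr do under eq_bigr do rewrite horner_exp.
  eexists; apply: lead_termM.
    by apply: lead_termX; rewrite -const_tcofactor; apply: lead_term_const.
  by apply: lead_term_prod => i _; apply: lead_term_prod => i1 _; apply: lead_termX.
have valE : cofactor_at nu (a l) ^+ (2 * mult nu - 2) *
    (\prod_(i < mult nu) \prod_(i1 < mult nu | (i < i1)%N) (v i - v i1) ^+ 2) =
    (-1) ^+ (b + (mult nu).-1) * (mult nu)%:R ^+ mult nu *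
    ((map_poly j de).[a l] / (map_poly j al).[a l] * cofactor_at nu (a l))
      ^+ (mult nu).-1.
  rewrite bE; have -> : (2 * mult nu - 2 = (mult nu).-1 + (mult nu).-1)%N.
    by rewrite addnn -mul2n -subn1 mulnBr.
  move: (_ / _) (cofactor_at _ _) (cofactor_at_neq0 l) => D q q0.
  have -> : D * q = q * q * (D / q) by field.
  have -> : - D / q = - 1 * (D / q) by field.
  by rewrite !exprMn !exprD; ring.
exists (b + (mult nu).-1)%N; rewrite -valE; apply: lowcoef_lead_term disc_lead.
rewrite valE !mulf_neq0 ?expf_neq0 ?oppr_eq0 ?oner_neq0 //.
by rewrite !mulf_neq0 ?invr_eq0 ?cofactor_at_neq0.
Qed.
End Zeuthen.

Lemma lowcoef_disc1 (nu : 'I_r) x : mult nu = 1%N ->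
  lowcoef (gen_disc j n' N F f s nu).[fpsC x] = 1.
Proof.
move=> m1; have -> : gen_disc j n' N F f s nu = 1.
  rewrite /gen_disc [X in (2 * X)%N]m1 mul1r big1 // => i _; apply: big_pred0 => i1.
  by have := ltn_ord i1; rewrite [X in (_ < X)%N]m1 ltnS leqn0 => /eqP ->.
rewrite hornerC; apply: lowcoef_lead_term (lead_term_const 1).
by rewrite rmorph1 oner_neq0.
Qed.

End DiscriminantAtRoot.

(** * Equality up to constants of k, resultants and exponents *)

Section UpToConstants.
Variables (k : fieldType) (L : fieldType) (psi : {rmorphism k -> L}).

(** Absorbs the signs and the factors m^m, all of which come from k. *)
Definition eq_upto (x y : L) := exists2 c : k, c != 0 & x = psi c * y.

Lemma eq_upto_refl x : eq_upto x x.
Proof. by exists 1; rewrite ?oner_neq0 // rmorph1 mul1r. Qed.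

Lemma eq_upto_trans y x z : eq_upto x y -> eq_upto y z -> eq_upto x z.
Proof.
move=> [c c0 ->] [c1 c10 ->]; exists (c * c1); first by rewrite mulf_neq0.
by rewrite rmorphM mulrA.
Qed.

Lemma eq_uptoM x1 x2 y1 y2 :
  eq_upto x1 x2 -> eq_upto y1 y2 -> eq_upto (x1 * y1) (x2 * y2).
Proof.
move=> [c c0 ->] [c1 c10 ->]; exists (c * c1); first by rewrite mulf_neq0.
by rewrite rmorphM; ring.
Qed.

Lemma eq_upto_prod (I : Type) (r : seq I) (P : pred I) (x y : I -> L) :
    (forall i, P i -> eq_upto (x i) (y i)) ->
  eq_upto (\prod_(i <- r | P i) x i) (\prod_(i <- r | P i) y i).
Proof.
by move=> xy; apply: (big_ind2 eq_upto) => //; [apply: eq_upto_refl|apply: eq_uptoM].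
Qed.

End UpToConstants.

(** By unique factorization the root list chosen by [closed_field_poly_normal] is a permutation of
    the [a l]. *)
Lemma Res_prod_XsubC (L : closedFieldType) d (a : 'I_d -> L) (g : {poly L}) :
  Res (\prod_(l < d) ('X - (a l)%:P)) g = \prod_(l < d) g.[a l].
Proof.
rewrite /Res; case: closed_field_poly_normal => zs /=.
have /eqP -> : \prod_(l < d) ('X - (a l)%:P) \is monic by apply: monic_prod_XsubC.
rewrite scale1r expr1n mul1r => zsE.
have /(perm_big _) -> : perm_eq zs [seq a l | l <- index_enum 'I_d].
  by apply: prod_XsubC_eq; rewrite -zsE big_map.
by rewrite big_map.
Qed.

Lemma Res_sym (L : closedFieldType) d d1 (a : 'I_d -> L) (a1 : 'I_d1 -> L)
    (p := \prod_(l < d) ('X - (a l)%:P)) (p1 := \prod_(l < d1) ('X - (a1 l)%:P)) :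
  Res p1 p = (-1) ^+ (d * d1) * Res p p1.
Proof.
rewrite !Res_prod_XsubC mulnC.
under eq_bigr do rewrite horner_prod.
under [in RHS]eq_bigr do rewrite horner_prod.
rewrite exchange_big /= exprM.
transitivity (\prod_(l < d) ((-1) ^+ d1 * \prod_(l1 < d1) ('X - (a1 l1)%:P).[a l])).
  apply: eq_bigr => l _; rewrite -[X in _ ^+ X * _](card_ord d1) -prodrN.
  by apply: eq_bigr => l1 _; rewrite !hornerXsubC opprB.
by rewrite big_split /= prodr_const card_ord -!exprM mulnC.
Qed.

Lemma coprimeK_root (A : idomainType) (L : fieldType)
    (iota : {rmorphism {fraction A} -> L}) (p q : {poly A}) (x : L) :
    coprimeK p q -> (map_poly (iota \o @tofrac A) q).[x] = 0 ->
  (map_poly (iota \o @tofrac A) p).[x] != 0.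
Proof.
rewrite /coprimeK coprimep_sym -(coprimep_map iota) !map_poly_comp => pq qx.
by apply: coprimep_root pq _; rewrite /root qx.
Qed.

(** Here x is Res(f_nu, f_nu1): the first two powers come from the discriminants at nu and nu1, the
    third, possibly negative, from the definition of [Ver]. *)
Lemma vertex_exponents (L : fieldType) (x : L) (m m1 : nat) :
    x != 0 -> (0 < m)%N -> (0 < m1)%N ->
  x ^+ (m1 * m.-1) * x ^+ (m * m1.-1) *
    x ^ (2%:Z * (m%:Z + m1%:Z - (m * m1)%N%:Z)) = x ^+ (m + m1).
Proof.
case: m m1 => [|m] [|m1] // x0 _ _; rewrite !exprnP -!expfzDr //; congr (_ ^ _).
by rewrite !PoszM !intS !PoszD /= ?PoszM; ring.
Qed.

(** * Assembling the vertex *)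

Theorem theorem3p7
  (k : closedFieldType) (chark : [pchar k] =i pred0)
  (A : idomainType) (phi : {rmorphism k -> A})
  (L : closedFieldType) (iota : {rmorphism {fraction A} -> L})
  (Lalg : forall z : L, algebraicOver iota z)
  (n' r : nat) (F : {fps {poly A}}) (hF : is_family n' F)
  (f : 'I_r -> {poly A}) (mult d : 'I_r -> nat)
  (a : forall nu : 'I_r, 'I_(d nu) -> L)
  (mult_gt0 : forall nu, (0 < mult nu)%N)
  (hF0 : fps_coef F 0 = \prod_(nu < r) f nu ^+ mult nu)
  (f_monic : forall nu, f nu \is monic)
  (f_coprime : forall nu nu1, nu != nu1 -> coprimeK (f nu) (f nu1))
  (f_roots : forall nu, map_poly (iota \o @tofrac A) (f nu) =
                          \prod_(l < d nu) ('X - (a nu l)%:P))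
  (a_inj : injective (fun p : {nu : 'I_r & 'I_(d nu)} => a (tag p) (tagged p)))
  (ord : 'I_r -> nat) (alpha delta : 'I_r -> {poly A})
  (hZd : forall nu, (1 < mult nu)%N ->
           Zd F (f nu) (mult nu) (ord nu) (alpha nu) (delta nu))
  (N : nat) (s : forall nu : 'I_r, 'I_(d nu) -> 'I_(mult nu) -> {fps L})
  (hs : is_troots (iota \o @tofrac A) n' N F a s) :
  let j := map_poly (iota \o @tofrac A) in
  exists c : k, c != 0 /\
    Ver (iota \o @tofrac A) n' N F f a s =
      iota (tofrac (phi c)) *
      (\prod_(nu < r | (1 < mult nu)%N)
          Res (j (f nu)) (j (delta nu ^+ (mult nu).-1))) *
      (\prod_(nu < r) \prod_(nu1 < r | nu1 != nu)
          Res (j (f nu)) (j (f nu1)) ^+ mult nu1) /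
      (\prod_(nu < r | (1 < mult nu)%N)
          Res (j (f nu)) (j (alpha nu ^+ (mult nu).-1))).
Proof.
move=> j; pose psi : {rmorphism k -> L} := iota \o @tofrac A \o phi.
pose R nu nu1 := Res (j (f nu)) (j (f nu1)).
have natk m : (0 < m)%N -> m%:R != 0 :> k.
  by move: (proj1 (pcharf0P k) chark m) => ->; rewrite lt0n.
have natL m : (0 < m)%N -> m%:R != 0 :> L.
  by move=> m0; rewrite -(rmorph_nat psi) fmorph_eq0 natk.
have ResE nu g : Res (j (f nu)) g = \prod_(l < d nu) g.[a nu l].
  by rewrite /j f_roots Res_prod_XsubC.
have R0 nu nu1 : nu1 != nu -> R nu nu1 != 0.
  move=> nuP; rewrite /R ResE; apply/prodf_neq0 => l _.
  exact: (f_nonroot f_roots a_inj).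
(* The value 1 at multiplicity 1 turns the restricted products of the statement into products over
   all nu. *)
pose D (g : 'I_r -> {poly A}) nu := if (1 < mult nu)%N
  then Res (j (f nu)) (j (g nu ^+ (mult nu).-1)) else 1.
pose V nu := \prod_(l < d nu)
  lowcoef (gen_disc (iota \o @tofrac A) n' N F f s nu).[fpsC (a nu l)].
(* Multiplying the local formula over the roots of f_nu turns values at the roots into
   resultants. *)
have Vcase nu : eq_upto psi (V nu)
    ((D delta nu / D alpha nu) *
     \prod_(nu1 < r | nu1 != nu) R nu nu1 ^+ (mult nu1 * (mult nu).-1)).
  rewrite /D; case: ltnP => [m_gt1|m_le1]; last first.
    have m1 : mult nu = 1%N by apply/eqP; rewrite eqn_leq m_le1 mult_gt0.
    rewrite divr1 mul1r big1 => [|nu1 _]; last by rewrite m1 muln0.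
    rewrite /V big1 => [|l _]; first exact: eq_upto_refl.
    exact: lowcoef_disc1.
  have zd := hZd nu m_gt1; have cop : coprimeK (alpha nu * delta nu) (f nu) by case: zd.
  have ad0 l : (j (alpha nu)).[a nu l] * (j (delta nu)).[a nu l] != 0.
    by rewrite -hornerM -rmorphM; apply: coprimeK_root cop _; apply: (f_root f_roots).
  have al0 l : (j (alpha nu)).[a nu l] != 0.
    by have := ad0 l; rewrite mulf_eq0 negb_or => /andP[].
  have de0 l : (j (delta nu)).[a nu l] != 0.
    by have := ad0 l; rewrite mulf_eq0 negb_or => /andP[].
  have Vl := Zd_lowcoef_disc hF hF0 f_monic f_roots a_inj hs zd
    (natL _ (mult_gt0 nu)) al0 de0.
  have -> : Res (j (f nu)) (j (delta nu ^+ (mult nu).-1)) /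
      Res (j (f nu)) (j (alpha nu ^+ (mult nu).-1)) *
      \prod_(nu1 < r | nu1 != nu) R nu nu1 ^+ (mult nu1 * (mult nu).-1) =
      \prod_(l < d nu) ((j (delta nu)).[a nu l] / (j (alpha nu)).[a nu l] *
        cofactor_at (iota \o @tofrac A) f mult nu (a nu l)) ^+ (mult nu).-1.
    have RE : \prod_(nu1 < r | nu1 != nu) R nu nu1 ^+ (mult nu1 * (mult nu).-1) =
        \prod_(l < d nu)
          cofactor_at (iota \o @tofrac A) f mult nu (a nu l) ^+ (mult nu).-1.
      transitivity (\prod_(nu1 < r | nu1 != nu) \prod_(l < d nu)
          (j (f nu1)).[a nu l] ^+ (mult nu1 * (mult nu).-1)).
        by apply: eq_bigr => nu1 _; rewrite /R ResE prodrXl.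
      rewrite exchange_big /=; apply: eq_bigr => l _.
      rewrite /cofactor_at -prodrXl; apply: eq_bigr => nu1 _; exact: exprM.
    rewrite RE !ResE -prodf_div -big_split /=; apply: eq_bigr => l _.
    by rewrite /j !rmorphXn /= !horner_exp exprMn expr_div_n.
  apply: eq_upto_prod => l _; have [b ->] := Vl l.
  (* This constant is taken in k, where m is nonzero by characteristic zero. *)
  exists ((-1) ^+ b * (mult nu)%:R ^+ mult nu).
    by rewrite mulf_neq0 ?expf_neq0 ?oppr_eq0 ?oner_neq0 ?natk.
  by rewrite rmorphM rmorph_sign rmorphXn rmorph_nat.
(* The contribution of one pair: with R nu1 nu = +- R nu nu1 everything is a power of one resultant,
   and the sign e is left with exponent m (m1 - 1) on one side and m on the other. *)
have pairE nu nu1 : nu1 != nu -> eq_upto psi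
    (R nu nu1 ^+ (mult nu1 * (mult nu).-1) * R nu1 nu ^+ (mult nu * (mult nu1).-1) *
     R nu nu1 ^ (2%:Z * ((mult nu)%:Z + (mult nu1)%:Z - (mult nu * mult nu1)%N%:Z)))
    (R nu nu1 ^+ mult nu1 * R nu1 nu ^+ mult nu).
  move=> nuP; have -> : R nu1 nu = psi ((-1) ^+ (d nu * d nu1)) * R nu nu1.
    by rewrite rmorph_sign /R /j !f_roots Res_sym.
  set e := _ ^+ (d nu * d nu1).
  have e0 : e != 0 by rewrite expf_neq0 ?oppr_eq0 ?oner_neq0.
  exists (e ^+ (mult nu * (mult nu1).-1) / e ^+ mult nu).
    apply: mulf_neq0; [|rewrite invr_eq0]; exact: expf_neq0.
  have expE := vertex_exponents (R0 _ _ nuP) (mult_gt0 nu) (mult_gt0 nu1).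
  have psiE : psi (e ^+ (mult nu * (mult nu1).-1) / e ^+ mult nu) =
      psi e ^+ (mult nu * (mult nu1).-1) / psi e ^+ mult nu.
    by rewrite fmorph_div; congr (_ / _); apply: rmorphXn.
  have : psi e ^+ mult nu != 0 by rewrite expf_neq0 // fmorph_eq0.
  rewrite psiE !(exprMn _ (psi e)) [X in X * _]mulrCA -[LHS]mulrA expE exprD.
  by move: (psi e ^+ mult nu) => x x0; field.
have [c c0 VerE] : eq_upto psi (Ver (iota \o @tofrac A) n' N F f a s)
  ((\prod_(nu < r) (D delta nu / D alpha nu)) *
   \prod_(nu < r) \prod_(nu1 < r | nu1 != nu) R nu nu1 ^+ mult nu1).
  have VerE : Ver (iota \o @tofrac A) n' N F f a s = (\prod_(nu < r) V nu) *
      \prod_(nu < r) \prod_(nu1 < r | (nu < nu1)%N) R nu nu1 ^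
        (2%:Z * ((mult nu)%:Z + (mult nu1)%:Z - (mult nu * mult nu1)%N%:Z)) by [].
  rewrite VerE; apply: eq_upto_trans.
    by apply: eq_uptoM (eq_upto_refl psi _); apply: eq_upto_prod => nu _; apply: Vcase.
  rewrite big_split /= -mulrA; apply: eq_uptoM; first exact: eq_upto_refl.
  (* Both products over ordered pairs are regrouped over nu < nu1, the indexing of the resultants in
     [Ver]. *)
  rewrite !prod_neq_pairs -big_split; apply: eq_upto_prod => nu _ /=.
  rewrite -big_split; apply: eq_upto_prod => nu1 nu_lt /=; apply: pairE.
  by rewrite -val_eqE neq_ltn nu_lt orbT.
exists c; split=> //; rewrite VerE big_split /= prodfV.
rewrite [in RHS]big_mkcond [X in _ = _ / X]big_mkcond /=.
by rewrite mulrAC !mulrA.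
Qed.
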